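(* If $f:X\to\mathbb R$ is Lebesgue integrable with respect to $\mu$, then $f$ is $D_\mu$-integrable (on $X$) and the values of the two integrals coincide.
   Context: $X$ is a compact metric space with metric $d$, $O_r(x)$ is the open ball of radius $r$ about $x$, and $\mu$ is a normalised Borel measure on $X$ (i.e. $\mu(X)=1$). Let $\mathcal B$ be a basis of open subsets of $X$ containing $\emptyset$ and closed under finite intersections (including the empty intersection, so $X\in\mathcal B$), and put $\mathbf C_{\mathcal B}=\{A_1\cap A_2^c: A_1,A_2\in\mathcal B\}$; its elements are called crescents. $\mathbf C_{\mathcal B}$ is partitionable if it is closed under finite intersections and, for all $C,C_0\in\mathbf C_{\mathcal B}$, the set $C\setminus C_0$ is a finite union of pairwise disjoint elements of $\mathbf C_{\mathcal B}$. Throughout, $\mathcal B$ is fixed with $\mathbf C_{\mathcal B}$ partitionable. A partition of $C\in\mathbf C_{\mathcal B}$ is a finite set of pairwise disjoint non-empty crescents in $\mathbf C_{\mathcal B}$ with union $C$. A gauge on $\overline C$ is a function $\gamma:\overline C\to\mathbb R$ with $\gamma(x)>0$ for all $x$. A tagged partition of $C$ is a finite set $\dot P=\{(R_i,t_i):1\le i\le n\}$ where $\{R_i\}$ is a partition of $C$ and $t_i\in\overline{R_i}$; it is $\gamma$-fine, written $\dot P\prec\gamma$, if $\overline{R_i}\subset O_{\gamma(t_i)}(t_i)$ for all $i$. Put $\int f\,d\mu_{\dot P,\gamma}=\sum_i f(t_i)\mu(R_i)$. A function $f:\overline C\to\mathbb R$ is $D_\mu$-integrable on $C$ with $D_\mu$-integral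 $\int_C f\,d\mu=r\in\mathbb R$ if for every $\epsilon>0$ there is a gauge $\gamma$ on $\overline C$ such that $|\int f\,d\mu_{\dot P,\gamma}-r|<\epsilon$ for every tagged partition $\dot P\prec\gamma$ of $C$; $\int f\,d\mu:=\int_X f\,d\mu$. A ($\mu$-measurable) function $f:X\to\mathbb R$ is Lebesgue integrable with respect to $\mu$ if the Lebesgue integrals of its positive part $\max\{f,0\}$ and of $-\min\{f,0\}$ are both finite; the Lebesgue integral of $f$ is then the difference of these two integrals. *)

(* Defs.v *)
From HB Require Import structures.
From mathcomp Require Import all_boot all_order all_algebra.
From mathcomp Require Import all_classical all_reals all_analysis.

Set Implicit Arguments.
Unset Strict Implicit.
Unset Printing Implicit Defensive.

Import Order.TTheory GRing.Theory Num.Theory.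
Import numFieldNormedType.Exports.

Local Open Scope classical_set_scope.
Local Open Scope ring_scope.

(* The library only builds generated sigma-algebras on pointed types.  This
   excludes nothing here: a space of total mass 1 is nonempty. *)
#[short(type="pmetricType")]
HB.structure Definition PointedMetric (K : numDomainType) :=
  { M of Metric K M & Pointed M }.

Notation borelType X := (g_sigma_algebraType (@open X)).

(* The completion of mu: the outer measure mu^* restricted to its Caratheodory
   measurable sets.  Measurability on its domain is "mu-measurability". *)
Notation completion mu := (@completed_measure_extension _ _ _ mu).

Section crescents.
Context {X : topologicalType}.
Implicit Types (B : set (set X)) (C : set X).

Record intersection_basis B : Prop := IntersectionBasis {
  ib_basis : basis B ;
  ib_set0 : B set0 ;
  ib_setT : B setT ;
  ib_setI : setI_closed B }.

Definition crescents B : set (set X) :=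
  [set C | exists A1 A2, [/\ B A1, B A2 & C = A1 `&` ~` A2]].

Definition partitionable (S : set (set X)) : Prop :=
  setI_closed S /\ semi_setD_closed S.

(* The parts are enumerated by 'I_n; being nonempty and pairwise disjoint, they
   are distinct.  The empty enumeration is the partition of the empty set. *)
Record tagged_partition B C := TaggedPartition {
  tp_size : nat ;
  tp_part : 'I_tp_size -> set X ;
  tp_tag : 'I_tp_size -> X ;
  tp_crescent : forall i, crescents B (tp_part i) ;
  tp_nonempty : forall i, tp_part i !=set0 ;
  tp_disjoint : trivIset setT tp_part ;
  tp_cover : \bigcup_i tp_part i = C ;
  tp_tag_closure : forall i, closure (tp_part i) (tp_tag i) }.

End crescents.

Arguments tp_size {X B C} _.
Arguments tp_part {X B C} _ _.
Arguments tp_tag {X B C} _ _.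

(* Functions and gauges on closure C are represented by functions on X; only
   their values on closure C matter, as all the tags lie in closure C. *)
Section gauge_integral.
Context {R : realType} {X : metricType R}.
Variables (mu : set X -> \bar R) (B : set (set X)) (C : set X).
Implicit Types (gamma f : X -> R) (P : tagged_partition B C).

Definition gauge gamma : Prop := forall x, closure C x -> 0 < gamma x.

Definition gauge_fine gamma P : Prop :=
  forall i, closure (tp_part P i) `<=` ball (tp_tag P i) (gamma (tp_tag P i)).

Definition riemann_sum f P : R :=
  \sum_(i < tp_size P) f (tp_tag P i) * fine (mu (tp_part P i)).

Definition has_Dintegral f (r : R) : Prop :=
  forall eps : R, 0 < eps -> exists2 gamma, gauge gamma &
    forall P, gauge_fine gamma P -> `|riemann_sum f P - r| < eps.

Definition Dintegrable f : Prop := exists r, has_Dintegral f r.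

Definition Dintegral f : R := get [set r | has_Dintegral f r].

End gauge_integral.

(* Main.v *)
(* It suffices to find, for every integrable f, a gauge whose fine Riemann sums
   are at most the integral of f plus epsilon, since the lower bound is the same
   statement for -f.  After truncating f from below and adding a constant, f is
   nonnegative; it is then dominated by a step function over its superlevel sets
   {f > h k}, which outer regularity allows to enlarge to open sets, and the
   gauge is read off these open sets.  The D-integral is determined by its
   defining property because every gauge admits a fine tagged partition (Cousin's
   lemma for crescents). *)
Require Import Defs.
From HB Require Import structures.
From mathcomp Require Import all_boot all_order all_algebra.
From mathcomp Require Import all_classical all_reals all_analysis.
From mathcomp Require Import measurable_realfun.
Import Order.TTheory GRing.Theory Num.Theory.
Import numFieldNormedType.Exports.
Local Open Scope classical_set_scope.
Local Open Scope ring_scope.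

Set Implicit Arguments.
Unset Strict Implicit.
Unset Printing Implicit Defensive.

(** * Assembling fine tagged partitions from pieces *)

Section fine_partitions.
Context {R : realType} {X : metricType R}.
Variables (B : set (set X)) (gamma : X -> R).

Definition finely_partitioned (C : set X) : Prop :=
  exists P : tagged_partition B C, gauge_fine gamma P.

Lemma finely_partitioned0 : finely_partitioned set0.
Proof.
have e0 : forall i : 'I_0, False by case.
unshelve eexists.
  (* [X] carries no point here, so the tag function is drawn from the emptiness of ['I_0]. *)
  apply: (@TaggedPartition X B set0 0 (fun=> set0) (fun i => False_rect X (e0 i))).
  - by case.
  - by case.
  - by case.
  - by rewrite bigcup0.
  - by case.
by case.
Qed.

Lemma finely_partitioned1 (C : set X) (t : X) : crescents B C -> C !=set0 ->
  closure C t -> closure C `<=` ball t (gamma t) -> finely_partitioned C.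
Proof.
move=> BC C0 Ct tC; unshelve eexists.
  apply: (@TaggedPartition X B C 1 (fun=> C) (fun=> t)) => //.
  - by move=> i j _ _ _; rewrite !ord1.
  - by rewrite eqEsubset; split=> [x [//]|x Cx]; exists ord0.
by [].
Qed.

Lemma finely_partitionedU (C D : set X) : C `&` D = set0 ->
  finely_partitioned C -> finely_partitioned D -> finely_partitioned (C `|` D).
Proof.
move=> CD0 [P Pg] [Q Qg].
have PC i : tp_part P i `<=` C.
  by rewrite -[X in _ `<=` X](tp_cover P); exact: bigcup_sup.
have QD i : tp_part Q i `<=` D.
  by rewrite -[X in _ `<=` X](tp_cover Q); exact: bigcup_sup.
pose part (i : 'I_(tp_size P + tp_size Q)) :=
  match fintype.split i with inl j => tp_part P j | inr j => tp_part Q j end.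
pose tag (i : 'I_(tp_size P + tp_size Q)) :=
  match fintype.split i with inl j => tp_tag P j | inr j => tp_tag Q j end.
unshelve eexists.
  apply: (@TaggedPartition X B (C `|` D) _ part tag).
  - by move=> i; rewrite /part; case: fintype.split => j; exact: tp_crescent.
  - by move=> i; rewrite /part; case: fintype.split => j; exact: tp_nonempty.
  - move=> i j _ _; rewrite /part -{2}(splitK i) -{2}(splitK j).
    case: (fintype.split i) => i'; case: (fintype.split j) => j'.
    + by move=> /(@tp_disjoint _ _ _ P _ _ I I) ->.
    + by move=> [x [/PC Cx /QD Dx]]; have : (C `&` D) x by []; rewrite CD0.
    + by move=> [x [/QD Dx /PC Cx]]; have : (C `&` D) x by []; rewrite CD0.
    + by move=> /(@tp_disjoint _ _ _ Q _ _ I I) ->.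
  - rewrite eqEsubset; split=> [x [i _]|x].
      by rewrite /part; case: fintype.split => j => [/PC|/QD]; [left|right].
    move=> []; [rewrite -[X in X x -> _](tp_cover P)|
      rewrite -[X in X x -> _](tp_cover Q)] => -[i _ xi].
      by exists (unsplit (inl i)) => //; rewrite /part unsplitK.
    by exists (unsplit (inr i)) => //; rewrite /part unsplitK.
  - by move=> i; rewrite /part /tag; case: fintype.split => j; exact: tp_tag_closure.
by move=> i; rewrite /= /part /tag; case: fintype.split => j; [exact: Pg|exact: Qg].
Qed.

Lemma finely_partitioned_bigcup (D : set (set X)) : finite_set D ->
  trivIset D id -> (forall A, D A -> finely_partitioned A) ->
  finely_partitioned (\bigcup_(A in D) A).
Proof.
move=> /finite_seqP[s ->{D}]; elim: s => [|A s IH] tI fp.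
  by rewrite set_nil bigcup_set0; exact: finely_partitioned0.
have tI' : trivIset [set` s] id.
  by apply: sub_trivIset tI => C; rewrite /= inE orbC => ->.
have {IH tI' }IH : finely_partitioned (\bigcup_(C in [set` s]) C).
  by apply: IH => // C Cs; apply: fp; rewrite /= inE orbC Cs.
rewrite bigcup_seq big_cons -bigcup_seq.
(* The list enumerating [D] may repeat a set: a repeated head adds nothing to the union, and a new
   one is disjoint from the rest. *)
have [As|As] := boolP (A \in s).
  rewrite (_ : _ `|` _ = \bigcup_(C in [set` s]) C)//.
  by apply/setUidPr; exact: (@bigcup_sup _ _ A _ id).
apply: finely_partitionedU => //; last by apply: fp; rewrite /= inE eqxx.
rewrite -subset0 => x [Ax [C /= Cs Cx]].
have AC : A = C.
  apply: tI => /=; rewrite ?inE ?eqxx ?Cs ?orbT//.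
  by exists x.
by move: As; rewrite AC Cs.
Qed.

(** Lets one partition obey two gauges at once: those bounding the sums of [f] and of [- f], or
    those of two candidate integrals. *)
Lemma gauge_fine_min (g1 g2 : X -> R) (C : set X) (P : tagged_partition B C) :
  gauge_fine (fun x => Num.min (g1 x) (g2 x)) P ->
  gauge_fine g1 P /\ gauge_fine g2 P.
Proof.
move=> fP; split=> i; apply: subset_trans (fP i) (le_ball _).
  by rewrite ge_min lexx.
by rewrite ge_min lexx orbT.
Qed.

End fine_partitions.

(** * Existence of fine tagged partitions *)

Section cousin.
Context {R : realType} {X : pmetricType R}.
Variables (B : set (set X)) (gamma : X -> R).
Hypotheses (Xcompact : compact [set: X]) (B_basis : intersection_basis B).
Hypotheses (B_partitionable : partitionable (crescents B)).

Let unpartitioned (C : set X) := crescents B C /\ ~ finely_partitioned B gamma C.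

Lemma crescents_basis (A : set X) : B A -> crescents B A.
Proof.
move=> BA; exists A, set0; split => //; first exact: ib_set0 B_basis.
by rewrite setC0 setIT.
Qed.

(** Split [C] along the head [A] of the list. If the part inside [A] has a fine partition, then some
    crescent in the decomposition of the part outside has none, as otherwise gluing would give one
    for [C]; that crescent is covered by the tail. *)
Lemma unpartitioned_cover (C : set X) (s : seq (set X)) : unpartitioned C ->
  (forall A, A \in s -> B A) -> C `<=` \bigcup_(A in [set` s]) A ->
  exists2 C', unpartitioned C' /\ C' `<=` C &
    exists2 A, A \in s & C' `<=` A.
Proof.
elim: s C => [|A s IH] C [BC nC] Bs Csub.
  exfalso; apply: nC; suff -> : C = set0 by exact: finely_partitioned0.
  by move: Csub; rewrite set_nil bigcup_set0 subset0.
have BA : B A by apply: Bs; rewrite inE eqxx.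
have [fCA|nCA] := pselect (finely_partitioned B gamma (C `&` A)); last first.
  exists (C `&` A); last by exists A; [rewrite inE eqxx|exact: subIsetr].
  split; last exact: subIsetl.
  by split => //; apply: B_partitionable.1 => //; exact: crescents_basis.
have [D [fD DB CAD tD]] := B_partitionable.2 _ _ BC (crescents_basis BA).
have [E DE nE] : exists2 E, D E & ~ finely_partitioned B gamma E.
  apply: contrapT => fE; apply: nC; rewrite -(setDUK (@subIsetl _ C A)).
  apply: finely_partitionedU => //; first by rewrite setDE setICA setICr setI0.
  rewrite setDIr setDv set0U CAD; apply: finely_partitioned_bigcup => // E DE.
  by apply: contrapT => nE; apply: fE; exists E.
have EC : E `<=` C `\` A by rewrite CAD; exact: (@bigcup_sup _ _ E _ id).
have [|||C' [bC' C'E] [A' A's C'A']] := IH E.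
- by split => //; exact: DB.
- by move=> A' A's; apply: Bs; rewrite inE A's orbT.
- move=> x /EC[/Csub[A' /= ]]; rewrite inE => /predU1P[->//|A's A'x nAx].
  by exists A'.
exists C'.
  by split => //; apply: subset_trans C'E (subset_trans EC _); exact: subDsetl.
by exists A' => //; rewrite inE A's orbT.
Qed.

(** The basic open sets lying in balls of radius [r] cover the space; compactness leaves finitely
    many of them for [unpartitioned_cover]. *)
Lemma unpartitioned_small (r : R) (C : set X) : 0 < r -> unpartitioned C ->
  exists2 C', unpartitioned C' /\ C' `<=` C & exists z, C' `<=` ball z r.
Proof.
move=> r0 bC; pose D := [set A | B A /\ exists z, A `<=` ball z r].
have Dop A : D A -> open A by move=> [/(ib_basis B_basis).1].
have Dcov : [set: X] `<=` cover D id.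
  move=> x _; have /(ib_basis B_basis).2[A [BA Ax] Ar] : nbhs x (ball x r).
    exact: nbhsx_ballx.
  by exists A => //; split => //; exists x.
have := Xcompact; rewrite compact_cover => /(_ _ D id Dop Dcov)[F FD Fcov].
have [||C' bC' [A AF C'A]] := @unpartitioned_cover C (finmap.enum_fset F) bC.
- by move=> A /FD; rewrite inE => -[].
- by move=> x _; have [A FA Ax] := Fcov x I; exists A.
exists C' => //; have := FD _ AF; rewrite inE => -[_ [z Az]].
by exists z; exact: subset_trans Az.
Qed.

(* Cousin's lemma: otherwise there is a decreasing sequence of crescents of
   vanishing diameter without a fine tagged partition; a common point of
   their closures tags a small enough one of them alone. *)
Lemma cousin : gauge [set: X] gamma -> finely_partitioned B gamma [set: X].
Proof.
move=> gamma_gt0; apply: contrapT => nX.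
have bX : unpartitioned setT.
  by split => //; apply: crescents_basis; exact: ib_setT B_basis.
have [next nextP] : {next : nat * set X -> set X &
    forall p, unpartitioned p.2 ->
      [/\ unpartitioned (next p), next p `<=` p.2 &
          exists z, next p `<=` ball z (p.1.+1%:R^-1)]}.
  apply: (@choice _ _ (fun p C => unpartitioned p.2 ->
      [/\ unpartitioned C, C `<=` p.2 &
          exists z, C `<=` ball z (p.1.+1%:R^-1)])) => -[n C] /=.
  (* [set0] is a default value, never reached from [setT]. *)
  have [bC|nbC] := pselect (unpartitioned C); last by exists set0.
  have r0 : 0 < n.+1%:R^-1 :> R by rewrite invr_gt0.
  by have [C' [? ?] ?] := unpartitioned_small r0 bC; exists C'.
pose C := fix C n := if n is m.+1 then next (m, C m) else setT.
have bC n : unpartitioned (C n) by elim: n => //= n /(nextP (n, _))[].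
have CS n : C n.+1 `<=` C n by have [] := nextP (n, C n) (bC n).
have Csmall n : exists z, C n.+1 `<=` ball z n.+1%:R^-1.
  by have [] := nextP (n, C n) (bC n).
have Cmono n k : C (k + n)%N `<=` C n.
  by elim: k => // k IH; apply: subset_trans IH; exact: CS.
have C0 n : C n !=set0.
  apply/set0P/eqP => Cn0; apply: (bC n).2; rewrite Cn0.
  exact: finely_partitioned0.
pose x n := projT1 (cid (C0 n)).
have xC n : C n (x n) by rewrite /x; case: cid.
have [p [_ xp]] := @Xcompact (x @ \oo) _ filterT.
have clC n : closure (C n) p.
  move=> V pV; apply: xp => //; exists n => // k /= nk.
  by rewrite -(subnK nk); exact/Cmono/xC.
have gp : 0 < gamma p by apply: gamma_gt0; exact: subset_closure.
(* The factor 4 counts the hops from [p] to a point [y] of the closure: [p] to [p'], to the centre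
   [z], to [y'], to [y], where [p'] and [y'] lie in [C n.+1] close to [p] and [y]. *)
have [n ng] : exists n, 4 * n.+1%:R^-1 <= gamma p.
  exists (Num.truncn (4 / gamma p)).
  rewrite -ler_pdivlMl// [leRHS]mulrC -[leRHS]invf_div.
  by rewrite lef_pV2 ?posrE ?divr_gt0//; exact/ltW/truncnS_gt.
apply: (bC n.+1).2; apply: (@finely_partitioned1 _ _ _ _ _ p) => //.
  exact: (bC n.+1).1.
apply: subset_trans (le_ball ng) => y Cy.
have r0 : 0 < n.+1%:R^-1 :> R by rewrite invr_gt0.
have [z Cz] := Csmall n.
have [p' [/Cz zp' pp']] := clC n.+1 _ (nbhsx_ballx p _ r0).
have [y' [/Cz zy' yy']] := Cy _ (nbhsx_ballx y _ r0).
have -> : 4 * n.+1%:R^-1 =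
    n.+1%:R^-1 + n.+1%:R^-1 + n.+1%:R^-1 + n.+1%:R^-1 :> R.
  by rewrite mulr_natl !mulrSr mulr0n add0r.
apply: ball_triangle (ball_sym yy'); apply: ball_triangle zy'.
exact: ball_triangle (ball_sym zp').
Qed.

End cousin.

(** * Outer regularity of the completed measure *)

Section regularity.
Context {R : realType} {X : pmetricType R} (mu : probability (borelType X) R).
Local Open Scope ereal_scope.

Lemma borel_open (U : set X) : open U -> measurable (U : set (borelType X)).
Proof. exact: sub_sigma_algebra. Qed.

Lemma borel_closed (F : set X) : closed F -> measurable (F : set (borelType X)).
Proof.
move=> cF; rewrite -[F]setCK; apply: measurableC.
by apply: borel_open; exact: closed_openC.
Qed.

(** Approximating from inside by closed sets as well as from outside by open ones makes the property
    symmetric under complement, so that the regular sets form a sigma-algebra. *)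
Let regular (A : set X) := forall e : R, (0 < e)%R -> exists F U : set X,
  [/\ closed F, open U, F `<=` A, A `<=` U & mu (U `\` F) < e%:E].

(** Continuity from above, available because [mu] is finite. *)
Let decreasing_small (G : (set X)^nat) (e : R) :
  (forall n, measurable (G n : set (borelType X))) -> nonincreasing_seq G ->
  mu (\bigcap_n G n) < e%:E -> exists n, mu (G n) < e%:E.
Proof.
move=> mG dG Ge; have mI : measurable (\bigcap_n G n : set (borelType X)).
  exact: bigcapT_measurable.
have G0 : mu (G 0%N) < +oo.
  by rewrite (le_lt_trans (probability_le1 mu (mG _)))// ltry.
have := nonincreasing_cvg_mu G0 mG mI dG.
move=> /(_ [set x | x < e%:E]) [|n _ /(_ n (leqnn n))]; last by exists n.
by apply: open_nbhs_nbhs; split => //; exact: open_ereal_lt_ereal.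
Qed.

(** The open set serves as its own [U], and the complement of [G n] as [F]. The difference of the
    two decreases to the empty set, since each point of [A] has a ball inside [A]. *)
Let regular_open (A : set X) : open A -> regular A.
Proof.
move=> oA e e0; pose G n := \bigcup_(y in ~` A) (ball y n.+1%:R^-1)^°.
have oG n : open (G n) by apply: bigcup_open => y _; exact: open_interior.
have AG n : ~` A `<=` G n.
  move=> y nAy; exists y => //; apply: nbhsx_ballx.
  by rewrite invr_gt0.
have GA : \bigcap_n (A `&` G n) = set0.
  rewrite -subset0 => x AGx; have [Ax _] := AGx 0%N I.
  have /nbhs_ballP[r /= r0 rA] : nbhs x A by exact: open_nbhs_nbhs.
  have [n nr] : exists n, (n.+1%:R^-1 <= r :> R)%R.
    exists (Num.truncn r^-1); rewrite -[leRHS]invrK.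
    by rewrite lef_pV2 ?posrE ?invr_gt0//; exact/ltW/truncnS_gt.
  have [_ [y nAy /interior_subset yx]] := AGx n I.
  exact/nAy/rA/(le_ball nr)/ball_sym.
have mAG n : measurable (A `&` G n : set (borelType X)).
  by apply: measurableI; exact: borel_open.
have [||n ne] := @decreasing_small (fun n => A `&` G n) e mAG.
- move=> m n mn; rewrite subsetEset; apply: setIS => x [y nAy yx].
  exists y => //; apply: interiorS yx; apply: le_ball.
  by rewrite lef_pV2 ?posrE// ler_nat.
- by rewrite GA measure0 lte_fin.
exists (~` G n), A; split => //; first exact: open_closedC.
  by rewrite -[X in _ `<=` X]setCK; exact: subsetC.
by rewrite setDE setCK.
Qed.

Let regular_setC (A : set X) : regular A -> regular (~` A).
Proof.
move=> rA e e0; have [F [U [cF oU FA AU UFe]]] := rA e e0.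
exists (~` U), (~` F); split.
- exact: open_closedC.
- exact: closed_openC.
- exact: subsetC.
- exact: subsetC.
- by rewrite setDE setCK setIC -setDE.
Qed.

(** The union of all the [F n] need not be closed, so only finitely many are kept;
    [decreasing_small] tells how many suffice. *)
Let regular_bigcup (A : (set X)^nat) :
  (forall n, regular (A n)) -> regular (\bigcup_n A n).
Proof.
(* Countable subadditivity yields only a weak inequality, so the errors are made to add up to
   [e / 2]. *)
move=> rA e e0; have e20 : (0 < e / 2)%R by rewrite divr_gt0.
have e2n0 n : (0 < (e / 2) / (2 ^ n.+1)%:R)%R by rewrite divr_gt0.
have [F /= FP] := choice (fun n => rA n _ (e2n0 n)).
have [U /= FU] := choice FP.
have oU : open (\bigcup_n U n) by apply: bigcup_open => n _; have [] := FU n.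
have cF n : closed (\bigcup_(i < n) F i).
  rewrite bigcup_mkord.
  by apply: closed_bigsetU => i _; have [] := FU i.
pose G n := \bigcup_n U n `\` \bigcup_(i < n) F i.
have mG n : measurable (G n : set (borelType X)).
  by apply: measurableD; [exact: borel_open|exact: borel_closed].
have [||n ne] := @decreasing_small G e mG.
- move=> m n mn; rewrite subsetEset; apply: setDS => x [i /= im Fx].
  by exists i => //=; exact: leq_trans mn.
- have GUF : \bigcap_n G n `<=` \bigcup_n (U n `\` F n).
    move=> x Gx; have [[n _ Ux] _] := Gx 0%N I; exists n => //; split => // Fx.
    by have [_] := Gx n.+1 I; apply; exists n => /=.
  have mUF n : measurable (U n `\` F n : set (borelType X)).
    have [cFn oUn _ _ _] := FU n.
    by apply: measurableD; [exact: borel_open|exact: borel_closed].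
  apply: (@le_lt_trans _ _ (e / 2)%:E); last first.
    by rewrite lte_fin ltr_pdivrMr// ltr_pMr ?ltr1n.
  have mGI : measurable (\bigcap_n G n : set (borelType X)).
    exact: bigcapT_measurable.
  apply: (le_trans (measure_sigma_subadditive mu mUF mGI GUF)).
  apply: le_trans (epsilon_trick0 xpredT (ltW e20)).
  by apply: lee_nneseries => // n _; have [_ _ _ _ /ltW] := FU n.
exists (\bigcup_(i < n) F i), (\bigcup_n U n); split => //.
- move=> x [i _ Fx]; exists i => //; have [_ _ + _ _] := FU i; exact.
- by apply: subset_bigcup => i _; have [] := FU i.
Qed.

Lemma borel_regular (A : set (borelType X)) : measurable A -> forall e : R,
  (0 < e)%R -> exists F U : set X,
  [/\ closed F, open U, F `<=` A, A `<=` U & mu (U `\` F) < e%:E].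
Proof.
suff : @measurable _ (borelType X) `<=` regular by exact.
apply: smallest_sub; last exact: regular_open.
split.
- exact/regular_open/open0.
- by move=> C; rewrite setTD; exact: regular_setC.
- exact: regular_bigcup.
Qed.

(** The value of the completion at any set [A] is an infimum over countable Borel covers. Half of
    [e] goes to choosing a cover, half to enlarging its union to an open set. *)
Lemma completion_outer_regular (A : set X) (e : R) : (0 < e)%R ->
  exists U : set X, [/\ open U, A `<=` U & mu U <= completion mu A + e%:E].
Proof.
move=> e0; have e20 : (0 < e / 2)%R by rewrite divr_gt0.
have Afin : completion mu A \is a fin_num.
  rewrite fin_num_abs gee0_abs ?mu_ext_ge0//.
  apply: (@le_lt_trans _ _ (mu_ext mu [set: X])); first exact: le_mu_ext.
  by rewrite measurable_mu_extE// (le_lt_trans (probability_le1 mu _))// ltry.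
have [_ [D [mD AD] <-] De] := lb_ereal_inf_adherent e20 Afin.
have mUD : measurable (\bigcup_n D n) by exact: bigcupT_measurable.
have [F [U [cF oU FD DU UFe]]] := borel_regular mUD e20.
exists U; split => //; first exact: subset_trans DU.
rewrite -(setDUK (subset_trans FD DU)) measureU//; last first.
- by rewrite setDE setICA setICr setI0.
- by apply: measurableD; [exact: borel_open|exact: borel_closed].
- exact: borel_closed.
rewrite [in leRHS](splitr e) EFinD addeA; apply: leeD; last exact: ltW.
apply: le_trans (ltW De).
apply: le_trans (measure_sigma_subadditive mu mD mUD (@subset_refl _ _)).
by apply: le_measure => //; rewrite inE//; exact: borel_closed.
Qed.

End regularity.

(** Makes the completion a probability in the instance below, so that its values are finite and
    constants are integrable. *)
Lemma completion_setT d (T : measurableType d) (R : realType)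
  (mu : probability T R) : completion mu setT = 1%E.
Proof.
by rewrite -(probability_setT mu); apply: measurable_mu_extE.
Qed.

HB.instance Definition _ d (T : measurableType d) (R : realType)
    (mu : probability T R) :=
  Measure_isProbability.Build _ _ _ (completion mu) (completion_setT mu).

(** * Step functions over superlevel sets *)

Section levels.
Context d (T : measurableType d) (R : realType) (nu : probability T R).
Variables (f : T -> R) (h : R).
Hypotheses (f_ge0 : forall x, 0 <= f x) (h_gt0 : 0 < h).
Hypothesis f_int : nu.-integrable setT (EFin \o f).

Let E (k : nat) : set T := [set x | h * k%:R < f x].

Lemma measurable_level k : measurable (E k).
Proof.
have mf : measurable_fun setT f by apply/measurable_EFinP/(measurable_int nu f_int).
rewrite (_ : E k = setT `&` f @^-1` `]h * k%:R, +oo[%classic).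
  exact: mf.
by rewrite setTI; apply/seteqP; split => x; rewrite /= in_itv/= andbT.
Qed.

(** Each [k] with [h * k] below [f x] contributes [h], and consecutive levels are [h] apart, so the
    sum overshoots [f x] by at most one step. *)
Lemma sum_level_le K x : \sum_(k < K) h * \1_(E k) x <= f x + h.
Proof.
(* The second bound strengthens the induction: when [h * K] is below [f x], it leaves room for one
   more [h]. *)
suff [] : \sum_(k < K) h * \1_(E k) x <= f x + h /\
  \sum_(k < K) h * \1_(E k) x <= h * K%:R by [].
elim: K => [|K [IH1 IH2]].
  by rewrite big_ord0 mulr0; split => //; rewrite addr_ge0// ltW.
rewrite big_ord_recr/= indicE -natr1 mulrDr mulr1.
have [Kf|fK] := ltP (h * K%:R) (f x).
  rewrite mem_set// mulr1.
  by split; rewrite lerD2r// (le_trans IH2)// ltW.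
rewrite memNset ?mulr0 ?addr0; last by rewrite /E/= ltNge fK.
by split => //; rewrite (le_trans IH2)// lerDl ltW.
Qed.

(** Integrates [sum_level_le]; the extra [h] is unchanged because [nu] has mass 1. *)
Lemma sum_measure_level_le K :
  \sum_(k < K) h * fine (nu (E k)) <= \int[nu]_x f x + h.
Proof.
pose g K x := \sum_(k < K) h * \1_(E k) x : R.
have iE k : nu.-integrable setT (EFin \o (fun x => h * \1_(E k) x)).
  have := integrableZl measurableT h (integrable_indic nu (measurable_level k)).
  by apply: eq_integrable.
have [ig <-] : nu.-integrable setT (EFin \o g K) /\
    \int[nu]_x g K x = \sum_(k < K) h * fine (nu (E k)).
  elim: K => [|K [ig IH]].
    have -> : g 0%N = cst 0 by apply/funext => x; rewrite /g big_ord0.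
    rewrite big_ord0 Rintegral_cst// mul0r; split => //.
    exact: (finite_measure_integrable_cst nu 0 measurableT).
  have gS : g K.+1 = fun x => g K x + h * \1_(E K) x.
    by apply/funext => x; rewrite /g big_ord_recr.
  split.
    have := integrableD measurableT ig (iE K).
    by apply: eq_integrable => // x _; rewrite /= gS.
  rewrite gS RintegralD// IH big_ord_recr/=; congr (_ + _).
  have iK := integrable_indic nu (measurable_level K).
  rewrite RintegralZl//.
  by rewrite /Rintegral integral_indic ?setIT//; exact: measurable_level.
have ih : nu.-integrable setT (EFin \o cst h).
  exact: finite_measure_integrable_cst.
have -> : \int[nu]_x f x + h = \int[nu]_x (f x + h).
  rewrite RintegralD// Rintegral_cst//; congr (_ + _).
  by rewrite [X in fine X](probability_setT nu) mulr1.
apply: le_Rintegral => //.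
  by have := integrableD measurableT f_int ih; apply: eq_integrable.
by move=> x _; exact: sum_level_le.
Qed.

End levels.

(** * Upper bound for the Riemann sums of a nonnegative function *)

Lemma sum_half_le1 (R : realFieldType) K : \sum_(k < K) (2 ^ k.+1)%:R^-1 <= 1 :> R.
Proof.
suff -> : \sum_(k < K) (2 ^ k.+1)%:R^-1 = 1 - (2 ^ K)%:R^-1 :> R.
  by rewrite lerBlDr lerDl invr_ge0.
elim: K => [|K IH]; first by rewrite big_ord0 expn0 invr1 subrr.
rewrite big_ord_recr/= IH -addrA; congr (_ + _).
by rewrite [in LHS](splitr (2 ^ K)%:R^-1) expnS natrM invfM mulrC opprD addrNK.
Qed.

Section upper_riemann_sums.
Context {R : realType} {X : pmetricType R} (mu : probability (borelType X) R).
Variables (B : set (set X)) (B_basis : intersection_basis B).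

Lemma crescent_measurable (C : set X) :
  crescents B C -> measurable (C : set (borelType X)).
Proof.
move=> [A1 [A2 [/(ib_basis B_basis).1 oA1 /(ib_basis B_basis).1 oA2 ->]]].
apply: measurableI; first exact: borel_open.
by apply: measurableC; exact: borel_open.
Qed.

Lemma sum_partition_measure (P : tagged_partition B setT)
    (U : set (borelType X)) : measurable U ->
  \sum_(i < tp_size P) fine (mu (tp_part P i `&` U)) = fine (mu U).
Proof.
move=> mU; have mP i : measurable (tp_part P i : set (borelType X)).
  by apply: crescent_measurable; exact: tp_crescent.
have mPU i : measurable (tp_part P i `&` U : set (borelType X)).
  exact: measurableI.
have EU : U = \big[setU/set0]_(i < tp_size P) (tp_part P i `&` U).
  rewrite -bigcup_seq -setI_bigcupl (_ : [set` _] = setT) ?tp_cover ?setTI//.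
  by apply/seteqP; split => // i _; exact: mem_index_enum.
have tPU : trivIset setT (fun i => tp_part P i `&` U).
  exact/trivIset_setIr/tp_disjoint.
rewrite [in RHS]EU (measure_bigsetU_ord _ xpredT mPU tPU) sum_fine//.
by move=> i _; exact: fin_num_measure.
Qed.

(* [gamma x] is chosen so that the ball around [x] lies in [U k] for each level
   [h * k] below [f x], where the open set [U k] contains [f > h * k] and is only
   slightly larger in measure.  A part tagged by [x] then lies in all these
   [U k], so the Riemann sum is at most the sum of the [h * mu (U k)]. *)
Lemma upper_riemann_sum_ge0 (f : X -> R) (e : R) : (forall x, 0 <= f x) ->
  (completion mu).-integrable setT (EFin \o f) -> 0 < e ->
  exists2 gamma : X -> R, gauge setT gamma &
    forall P : tagged_partition B setT, gauge_fine gamma P ->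
      riemann_sum mu f P <= \int[completion mu]_x f x + e.
Proof.
(* One half of [e] pays for the rounding of [f] to multiples of [h]. The other pays for enlarging
   the level sets, which costs [h] times a sum of the [(2 ^ k.+1)%:R^-1], at most [h]. *)
move=> f0 intf e0; pose h := e / 2; have h0 : 0 < h by rewrite divr_gt0.
pose E (k : nat) : set X := [set x | h * k%:R < f x].
have d0 k : 0 < (2 ^ k.+1)%:R^-1 :> R by rewrite invr_gt0.
have [U /= UP] := choice (fun k => completion_outer_regular mu (E k) (d0 k)).
have mU k : measurable (U k : set (borelType X)).
  by apply: borel_open; have [] := UP k.
have fn x : exists n : nat, f x <= h * n%:R.
  exists (Num.truncn (f x / h)).+1; rewrite -ler_pdivrMl// mulrC.
  exact/ltW/truncnS_gt.
(* By minimality, [k < n x] holds exactly when [h * k] is below [f x]. Only finitely many open sets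
   thus constrain the ball around [x]. *)
pose n x := ex_minn (fn x).
have fxn x : f x <= h * (n x)%:R by rewrite /n; case: ex_minnP.
have nU x k : (k < n x)%N -> U k x.
  rewrite /n; case: ex_minnP => m _ minm km; have [_ + _] := UP k; apply.
  by rewrite /E /= ltNge; apply/negP => /minm; rewrite leqNgt km.
have /choice[gamma gammaP] x : exists r : R, 0 < r /\
    ball x r `<=` [set y | forall i : 'I_(n x), U i y].
  have : nbhs x [set y | forall i : 'I_(n x), U i y].
    apply: filter_forall => i; apply: open_nbhs_nbhs; split.
      by have [] := UP i.
    exact: nU.
  by move=> /nbhs_ballP[r /= r0 rU]; exists r.
exists gamma => [x _|P fineP]; first by have [] := gammaP x.
(* A common range of levels for all tags, so that the two sums can be exchanged; the terms added are
   nonnegative. *)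
pose K := \max_(i < tp_size P) n (tp_tag P i).
have mP i : measurable (tp_part P i : set (borelType X)).
  by apply: crescent_measurable; exact: tp_crescent.
have PU i k : (k < n (tp_tag P i))%N -> tp_part P i `<=` U k.
  move=> kn x /subset_closure/fineP Px.
  by have [_ /(_ x Px) /(_ (Ordinal kn))] := gammaP (tp_tag P i).
apply: (@le_trans _ _ (\sum_(i < tp_size P) \sum_(k < K)
    h * fine (mu (tp_part P i `&` U k)))).
  apply: ler_sum => i _.
  have nK : (n (tp_tag P i) <= K)%N by exact: leq_bigmax.
  apply: (@le_trans _ _ (\sum_(k < n (tp_tag P i))
      h * fine (mu (tp_part P i `&` U k)))).
    rewrite (eq_bigr (fun=> h * fine (mu (tp_part P i)))); last first.
      by move=> k _; rewrite (setIidl (PU _ _ _)).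
    rewrite sumr_const card_ord -mulr_natl mulrA ler_wpM2r//.
      exact: fine_ge0.
    by rewrite mulrC.
  rewrite (big_ord_widen_cond K xpredT
    (fun k => h * fine (mu (tp_part P i `&` U k))))//.
  rewrite big_mkcond/=; apply: ler_sum => k _; case: ifP => // _.
  by rewrite mulr_ge0 ?fine_ge0// ltW.
(* For a fixed level [k], the traces of the parts on [U k] now add up to the measure of [U k]. *)
rewrite exchange_big/=.
apply: (@le_trans _ _ (\sum_(k < K)
    (h * fine (completion mu (E k)) + h * (2 ^ k.+1)%:R^-1))).
  apply: ler_sum => k _; rewrite -mulr_sumr sum_partition_measure//.
  rewrite -mulrDr ler_pM2l// -lee_fin EFinD !fineK//.
  - by have [] := UP k.
  - apply: fin_num_measure; exact: measurable_level intf _.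
  - exact: fin_num_measure.
rewrite big_split/= [e in leRHS](splitr e) addrA lerD//.
  exact: sum_measure_level_le.
by rewrite -mulr_sumr ger_pMr// sum_half_le1.
Qed.

End upper_riemann_sums.

(** * Truncation from below, and the D-integral of an integrable function *)

Lemma Rintegral_truncation d (T : measurableType d) (R : realType)
    (nu : {measure set T -> \bar R}) (f : T -> R) (e : R) :
  nu.-integrable setT (EFin \o f) -> 0 < e -> exists n : nat,
    nu.-integrable setT (fun x => (Num.max (f x) (- n%:R))%:E) /\
    \int[nu]_x Num.max (f x) (- n%:R) < \int[nu]_x f x + e.
Proof.
move=> intf e0; pose g (n : nat) x := Num.max (f x) (- n%:R).
have mf : measurable_fun setT f by apply/measurable_EFinP/(measurable_int nu intf).
have mg n : measurable_fun setT (EFin \o g n).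
  by apply/measurable_EFinP; exact: measurable_maxr.
have gf n x : `|g n x| <= `|f x|.
  rewrite /g; have [//|fn] := ltP (- n%:R) (f x).
  by rewrite normrN normr_nat ler0_norm 1?lerNr// (le_trans fn)//.
have intg n : nu.-integrable setT (EFin \o g n).
  by apply: le_integrable intf => // x _; rewrite lee_fin gf.
(* Dominated convergence with bound [|f|]: at each point the truncation has no effect once [n]
   exceeds [|f x|]. *)
have [_ _ cvg_int] : [/\ nu.-integrable setT (EFin \o f),
    (\int[nu]_x `|(EFin \o g n) x - (EFin \o f) x|)%E @[n --> \oo] --> 0%E &
    (\int[nu]_x (EFin \o g n) x)%E @[n --> \oo] --> (\int[nu]_x (EFin \o f) x)%E].
  apply: (@dominated_convergence _ _ _ nu _ measurableT
    (fun n => EFin \o g n) (EFin \o f) (abse \o (EFin \o f))) => //.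
  - exact: measurable_int intf.
  - apply: aeW => x _; apply: cvg_near_cst.
    exists (Num.truncn `|f x|).+1 => // n /= xn.
    rewrite /g max_l// lerNl (le_trans (ler_norm _))// normrN.
    by apply: ltW; apply: lt_le_trans (truncnS_gt _) _; rewrite ler_nat.
  - exact: integrable_abse.
  - by apply: aeW => x n _; rewrite /= lee_fin gf.
have intfE : (\int[nu]_x (EFin \o f) x)%E = (\int[nu]_x f x)%:E.
  by rewrite fineK//; exact: integrable_fin_num.
move: cvg_int; rewrite intfE => /(_ [set y | (y < (\int[nu]_x f x + e)%:E)%E]).
case=> [|n _ /(_ n (leqnn n)) /= gn].
  apply: open_nbhs_nbhs; split; first exact: open_ereal_lt_ereal.
  by rewrite /= lte_fin ltrDl.
exists n; split; first exact: intg.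
by rewrite -lte_fin fineK//; exact: (integrable_fin_num _ (intg n)).
Qed.

Section upper_riemann_sums_integrable.
Context {R : realType} {X : pmetricType R} (mu : probability (borelType X) R).
Variables (B : set (set X)) (B_basis : intersection_basis B).

(* Reduces to the nonnegative case by replacing f with max(f, -n) + n. *)
Lemma upper_riemann_sum (f : X -> R) (e : R) :
  (completion mu).-integrable setT (EFin \o f) -> 0 < e ->
  exists2 gamma : X -> R, gauge setT gamma &
    forall P : tagged_partition B setT, gauge_fine gamma P ->
      riemann_sum mu f P <= \int[completion mu]_x f x + e.
Proof.
move=> intf e0; have e20 : 0 < e / 2 by rewrite divr_gt0.
have [n [intg gfe]] := Rintegral_truncation intf e20.
pose g x := Num.max (f x) (- n%:R) + n%:R.
have intn : (completion mu).-integrable setT (EFin \o cst (n%:R : R)).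
  exact: finite_measure_integrable_cst.
have g0 x : 0 <= g x by rewrite -lerBlDr sub0r le_max lexx orbT.
have intg' : (completion mu).-integrable setT (EFin \o g).
  by have := integrableD measurableT intg intn; apply: eq_integrable.
have [gamma gamma0 gammaP] := upper_riemann_sum_ge0 B_basis g0 intg' e20.
exists gamma => // P /gammaP{gammaP}; rewrite RintegralD//.
rewrite Rintegral_cst// [X in fine X](completion_setT mu) mulr1 => gP.
have -> : \int[completion mu]_x f x + e =
    \int[completion mu]_x f x + e / 2 + n%:R + e / 2 - n%:R.
  by rewrite [in LHS](splitr e) addrA addrAC addrK.
rewrite lerBrDr; apply: (@le_trans _ _ (riemann_sum mu g P)); last first.
  by apply: le_trans gP _; rewrite !lerD2r ltW.
(* The parts have total measure 1, so the Riemann sum of the constant [n] equals its integral and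
   the shift cancels. *)
have muP : \sum_(i < tp_size P) fine (mu (tp_part P i)) = 1.
  rewrite -[RHS](congr1 fine (probability_setT mu)).
  rewrite -(sum_partition_measure mu B_basis P measurableT).
  by apply: eq_bigr => i _; rewrite setIT.
have -> : n%:R = \sum_(i < tp_size P) n%:R * fine (mu (tp_part P i)).
  by rewrite -mulr_sumr muP mulr1.
rewrite -big_split/=; apply: ler_sum => i _.
by rewrite -mulrDl ler_wpM2r ?fine_ge0// lerD2r le_max lexx.
Qed.

Lemma integrable_has_Dintegral (f : X -> R) :
  (completion mu).-integrable setT (EFin \o f) ->
  has_Dintegral mu B setT f (\int[completion mu]_x f x).
Proof.
(* The weak bounds of [upper_riemann_sum] at [e / 2] give the strict one at [e]. *)
move=> intf e e0; have e20 : 0 < e / 2 by rewrite divr_gt0.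
have intNf : (completion mu).-integrable setT (EFin \o (fun x => - f x)).
  by have := integrableN intf; apply: eq_integrable.
have [g1 g10 g1P] := upper_riemann_sum intf e20.
have [g2 g20 g2P] := upper_riemann_sum intNf e20.
exists (fun x => Num.min (g1 x) (g2 x)).
  by move=> x xX; rewrite lt_min g10// g20.
move=> P fP.
have [/g1P P1 /g2P P2] := gauge_fine_min fP.
have sN : riemann_sum mu (fun x => - f x) P = - riemann_sum mu f P.
  by rewrite /riemann_sum -sumrN; apply: eq_bigr => i _; rewrite mulNr.
have iN : \int[completion mu]_x - f x = - \int[completion mu]_x f x.
  under eq_Rintegral do rewrite -mulN1r.
  by rewrite RintegralZl// mulN1r.
move: P2; rewrite sN iN => P2.
apply: (@le_lt_trans _ _ (e / 2)).
  rewrite ler_norml lerBlDl P1 andbT lerBrDr addrC -lerN2.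
  by rewrite opprB addrC.
by rewrite ltr_pdivrMr// ltr_pMr// ltr1n.
Qed.

(** By [cousin] some partition is fine for the gauges of both values; its single Riemann sum is
    close to each of them. *)
Lemma has_Dintegral_unique (f : X -> R) (r s : R) :
  compact [set: X] -> partitionable (crescents B) ->
  has_Dintegral mu B setT f r -> has_Dintegral mu B setT f s -> r = s.
Proof.
move=> Xcompact Bpart fr fs; apply/eqP; rewrite -subr_eq0 -normr_le0.
apply/ler_addgt0Pl => e e0; rewrite addr0.
have e20 : 0 < e / 2 by rewrite divr_gt0.
have [g1 g10 g1P] := fr _ e20; have [g2 g20 g2P] := fs _ e20.
have g0 : gauge [set: X] (fun x => Num.min (g1 x) (g2 x)).
  by move=> x xX; rewrite lt_min g10// g20.
have [P fP] := cousin Xcompact B_basis Bpart g0.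
have [/g1P P1 /g2P P2] := gauge_fine_min fP.
rewrite (splitr e) (le_trans (ler_distD (riemann_sum mu f P) _ _))//.
by rewrite lerD// ltW// distrC.
Qed.

End upper_riemann_sums_integrable.

Theorem theorem4p12 (R : realType) (X : pmetricType R)
    (Xcompact : compact [set: X])
    (mu : probability (borelType X) R)
    (B : set (set X)) (B_basis : intersection_basis B)
    (B_partitionable : partitionable (crescents B))
    (f : X -> R)
    (f_integrable : (completion mu).-integrable setT (EFin \o f)) :
  Dintegrable mu B setT f /\
  Dintegral mu B setT f = \int[completion mu]_x f x.
Proof.
have Df := integrable_has_Dintegral B_basis f_integrable.
split; first by exists (\int[completion mu]_x f x).
(* [Dintegral] picks some value with the defining property; existence validates the choice, and
   uniqueness identifies it. *)
have Df' : has_Dintegral mu B setT f (Dintegral mu B setT f).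
  by apply: (@getPex _ [set r | has_Dintegral mu B setT f r]); eexists; exact: Df.
exact: (has_Dintegral_unique B_basis Xcompact B_partitionable Df' Df).
Qed.
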